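(* For all integers $n,m\ge0$ and every $x$, \[ \mathcal{B}_{n,m}^{(k)}(a,q,L;x)=\frac{(a+m)^k}{a^k}\sum_{i=0}^{n}\frac{i!\,(-q)^{n-i}\,l^{i+a}}{(a+m+i)^k}\mathcal{S}_n^i(x). \]
   Context: Let $k\ge1$ be an integer, $a,q,l_1,\dots,l_k$ nonzero reals, $l=\prod l_i$, $L=(l_1,\dots,l_k)$; denominators $a+j$ ($j\ge0$ integer) assumed nonzero and $l^{a+i}$ means $l^al^i$. Let $\operatorname{Li}_k(w;b)=\sum_{n\ge1}\frac{w^n}{(n+b)^k}$. The generalized $m$-poly-Bernoulli polynomials are defined by the formal power series identity in $z$ \[ \frac{q\,l^{a-1}(a+m)^k}{a^k}\,\frac{\operatorname{Li}_k\!\big(\frac{l}{q}(1-e^{-qz});a+m-1\big)}{e^{qzx}(1-e^{-qz})}=\sum_{n\ge0}\mathcal{B}_{n,m}^{(k)}(a,q,L;x)\frac{z^n}{n!}. \] The weighted Stirling numbers of the second kind are defined by $\sum_{n\ge i}\mathcal{S}_n^i(x)\frac{z^n}{n!}=\frac{1}{i!}e^{xz}(e^z-1)^i$. *)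

(* Defs.v *)
From HB Require Import structures.
From mathcomp Require Import all_boot all_order all_algebra.
From mathcomp Require Import complex.
From mathcomp Require Import boolp classical_sets reals exp trigo.

Set Implicit Arguments.
Unset Strict Implicit.
Unset Printing Implicit Defensive.

Import Order.TTheory GRing.Theory Num.Theory.

Local Open Scope ring_scope.
Local Open Scope complex_scope.

(* A formal power series \sum_n (f n) z^n is given by its coefficients. *)
Section FormalPowerSeries.
Variable F : fieldType.

Definition fps := nat -> F.

Implicit Types f g h : fps.

Definition fps_one : fps := fun n => (n == 0%N)%:R.
Definition fps_sub f g : fps := fun n => f n - g n.
Definition fps_scale (c : F) f : fps := fun n => c * f n.
Definition fps_mul f g : fps := fun n => \sum_(i < n.+1) f i * g (n - i)%N.
Definition fps_pow f (j : nat) : fps := iter j (fps_mul f) fps_one.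

(* e^{cz} *)
Definition fps_exp (c : F) : fps := fun n => c ^+ n / n`!%:R.

(* f(g(z)); meaningful only if g has no constant term, in which case g^j does
   not contribute to the coefficient of z^n for j > n. *)
Definition fps_comp f g : fps := fun n => \sum_(j < n.+1) f j * fps_pow g j n.

(* The formal quotient f/g when g divides f, see fps_divE; note that g may
   have a vanishing constant term.  The value is irrelevant otherwise. *)
Definition fps_div f g : fps :=
  xget (fun=> 0 : F) [set h | fps_mul h g = f]%classic.

Lemma fps_mulIf g : (exists n, g n != 0) ->
  forall h1 h2, fps_mul h1 g = fps_mul h2 g -> h1 = h2.
Proof.
move=> exg h1 h2 eqh; have [d gd0 dmin] := ex_minnP exg.
have glt i : (i < d)%N -> g i = 0.
  by move=> ltid; apply: contraTeq ltid => /dmin; rewrite -leqNgt.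
apply/funext => n; have [m] := ubnP n; elim: m n => // m IHm n ltnm.
have := congr1 (fun f => f (n + d)%N) eqh; rewrite /fps_mul.
have ltn : (n < (n + d).+1)%N by rewrite ltnS leq_addr.
rewrite (bigD1 (Ordinal ltn)) //= [in RHS](bigD1 (Ordinal ltn)) //= addKn.
have -> : \sum_(i < (n + d).+1 | i != Ordinal ltn) h1 i * g (n + d - i)%N =
          \sum_(i < (n + d).+1 | i != Ordinal ltn) h2 i * g (n + d - i)%N.
  apply: eq_bigr => i; rewrite -val_eqE /= neq_ltn => /orP[ltin|ltni].
    by rewrite IHm // (leq_trans ltin).
  by rewrite [g _]glt ?mulr0 // ltn_subLR ?ltn_add2r // -ltnS.
by move=> /addIr/(mulIf gd0).
Qed.

Lemma fps_divE f g h : (exists n, g n != 0) -> fps_mul h g = f ->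
  fps_div f g = h.
Proof.
move=> g0 hg; apply: (fps_mulIf g0); rewrite hg.
exact: (xgetPex (P := [set h | fps_mul h g = f]%classic) _ (ex_intro _ h hg)).
Qed.

(* The polylogarithm series \sum_(n >= 1) w^n / (n + b)^k in w. *)
Definition polylog (k : nat) (b : F) : fps :=
  fun n => if n == 0%N then 0 else ((n%:R + b) ^+ k)^-1.

(* Weighted Stirling numbers of the second kind S_n^i(x). *)
Definition wstirling2 (n i : nat) (x : F) : F :=
  n`!%:R * fps_scale (i`!%:R)^-1
    (fps_mul (fps_exp x) (fps_pow (fps_sub (fps_exp 1) fps_one) i)) n.

End FormalPowerSeries.

Section PolyBernoulli.
Variable R : realType.

Definition cis (t : R) : R[i] := cos t +i* sin t.

(* The base l may be negative and the exponent a an arbitrary real, so l^a is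
   complex in general and depends on the choice of an argument t of l. *)
Definition is_arg (l t : R) : Prop := l%:C = `|l|%:C * cis t.

(* l^(a + i) = l^a l^i for an integer i, where l^a = |l|^a e^(i a t). *)
Definition lpow (l t a : R) (i : int) : R[i] :=
  (`|l| `^ a)%:C * cis (a * t) * l%:C ^ i.

(* The generalized m-poly-Bernoulli polynomial B_{n,m}^{(k)}(a,q,L;x), for the
   argument t of l_1 ... l_k. *)
Definition polyBernoulli (k : nat) (a q : R) (L : 'I_k -> R) (t : R)
    (n m : nat) (x : R[i]) : R[i] :=
  let l := \prod_(i < k) L i in
  let u := fps_sub (fps_one _) (fps_exp (- q%:C)) in
  n`!%:R *
  fps_scale (q%:C * lpow l t a (-1) * ((a + m%:R) ^+ k / a ^+ k)%:C)
    (fps_div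
       (fps_comp (polylog k (a + m%:R - 1)%:C) (fps_scale (l / q)%:C u))
       (fps_mul (fps_exp (q%:C * x)) u)) n.

End PolyBernoulli.

(* Main.v *)
Require Import Defs.
From HB Require Import structures.
From mathcomp Require Import all_boot all_order all_algebra.
From mathcomp Require Import complex.
From mathcomp Require Import boolp classical_sets reals exp trigo.
From mathcomp Require Import ring.

(** Since [Li_k(w; b) = w * \sum_i w^i / (i + 1 + b)^k], the factor
    [1 - e^(-qz)] cancels in the generating function, which becomes a
    combination of the series [e^(-qxz) (1 - e^(-qz))^i].  Substituting
    [z := -qz] in the generating function of the weighted Stirling numbers turns
    it into exactly these series, up to the sign [(-1)^i]; the theorem follows by
    comparing coefficients. *)

Import Order.TTheory GRing.Theory Num.Theory.

Local Open Scope ring_scope.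
Local Open Scope complex_scope.

Section FormalPowerSeriesTheory.
Variable F : fieldType.
Implicit Types f g h : fps F.

(** Truncation turns convolution into a polynomial product, so the laws of [fps_mul] follow from
    those of polynomials. The bound [N] is free so that one truncation serves all lower coefficients
    as well, as associativity needs. *)
Lemma fps_mul_coefM N f g n : (n <= N)%N ->
  fps_mul f g n = ((\poly_(i < N.+1) f i) * \poly_(i < N.+1) g i)`_n.
Proof.
move=> leN; rewrite coefM; apply: eq_bigr => i _; rewrite !coef_poly !ltnS.
by rewrite (leq_trans _ leN) ?leq_ord // (leq_trans (leq_subr _ _) leN).
Qed.

Lemma fps_mulC f g : fps_mul f g = fps_mul g f.
Proof. by apply/funext => n; rewrite !(@fps_mul_coefM n) // mulrC. Qed.

Lemma fps_mulA f g h : fps_mul f (fps_mul g h) = fps_mul (fps_mul f g) h.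
Proof.
apply/funext => n.
pose T f := \poly_(i < n.+1) f i.
transitivity ((T f * T g * T h)`_n).
  rewrite -mulrA coefM; apply: eq_bigr => i _.
  by rewrite coef_poly ltn_ord (@fps_mul_coefM n) ?leq_subr.
rewrite coefM; apply: eq_bigr => i _.
by rewrite coef_poly ltnS leq_subr (@fps_mul_coefM n) ?leq_ord.
Qed.

Lemma fps_mul1l f : fps_mul (fps_one F) f = f.
Proof.
apply/funext => n; rewrite /fps_mul big_ord_recl /= /fps_one eqxx mul1r subn0.
by rewrite big1 ?addr0 // => i _; rewrite mul0r.
Qed.

Lemma fps_mul_scalel c f g :
  fps_mul (fps_scale c f) g = fps_scale c (fps_mul f g).
Proof.
apply/funext => n; rewrite /fps_mul /fps_scale big_distrr /=.
by apply: eq_bigr => i _; rewrite mulrA.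
Qed.

Lemma fps_mul_scaler c f g :
  fps_mul f (fps_scale c g) = fps_scale c (fps_mul f g).
Proof. by rewrite fps_mulC fps_mul_scalel fps_mulC. Qed.

Lemma fps_scale_scale c d f : fps_scale c (fps_scale d f) = fps_scale (c * d) f.
Proof. by apply/funext => n; rewrite /fps_scale mulrA. Qed.

Lemma fps_powS g j : fps_pow g j.+1 = fps_mul g (fps_pow g j).
Proof. by []. Qed.

Lemma fps_pow_scale c g j :
  fps_pow (fps_scale c g) j = fps_scale (c ^+ j) (fps_pow g j).
Proof.
elim: j => [|j IHj]; first by apply/funext => n; rewrite /fps_scale expr0 mul1r.
by rewrite !fps_powS IHj fps_mul_scalel fps_mul_scaler fps_scale_scale exprS.
Qed.

(** Without a constant term, [g] is divisible by $z$, hence its [j]-th power by $z^j$. *)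
Lemma fps_pow_small g j n : g 0%N = 0 -> (n < j)%N -> fps_pow g j n = 0.
Proof.
move=> g0; elim: j n => // j IHj n ltnj; rewrite fps_powS /fps_mul.
apply: big1 => -[[|i] lti] _ /=; first by rewrite g0 mul0r.
rewrite IHj ?mulr0 //; case: n lti ltnj => // n _ ltnj.
by rewrite subSS (leq_ltn_trans (leq_subr _ _)).
Qed.

Lemma fps_comp_widen f g n N : g 0%N = 0 -> (n <= N)%N ->
  fps_comp f g n = \sum_(j < N.+1) f j * fps_pow g j n.
Proof.
move=> g0 leN; rewrite /fps_comp.
rewrite (big_ord_widen _ (fun j => f j * fps_pow g j n) (leN : n < N.+1)%N).
rewrite big_mkcond /=; apply: eq_bigr => j _; case: ltnP => // ltnj.
by rewrite fps_pow_small ?mulr0.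
Qed.

Lemma fps_mul_comp f p g n : g 0%N = 0 ->
  fps_mul f (fps_comp p g) n =
  \sum_(j < n.+1) p j * fps_mul f (fps_pow g j) n.
Proof.
move=> g0; under [RHS]eq_bigr do rewrite /fps_mul big_distrr /=.
rewrite exchange_big /=; apply: eq_bigr => i _.
(* Widening the range of [j] from [n - i] to [n] makes it independent of [i], as the exchanged sums
   require. *)
rewrite (@fps_comp_widen _ _ _ n) ?leq_subr // big_distrr /=.
by apply: eq_bigr => j _; rewrite mulrCA.
Qed.

Lemma fps_comp_mulX p g : g 0%N = 0 -> p 0%N = 0 ->
  fps_comp p g = fps_mul g (fps_comp (fun n => p n.+1) g).
Proof.
move=> g0 p0; apply/funext => n; rewrite fps_mul_comp //.
(* One extra, vanishing term is added at the top, so that dropping the term [j = 0] leaves the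
   shifted sum over the right range. *)
by rewrite (@fps_comp_widen _ _ _ n.+1) // big_ord_recl /= p0 mul0r add0r.
Qed.

(* f(cz) *)
Definition fps_dilate (c : F) f : fps F := fun n => c ^+ n * f n.

Lemma fps_dilateM c f g :
  fps_dilate c (fps_mul f g) = fps_mul (fps_dilate c f) (fps_dilate c g).
Proof.
apply/funext => n; rewrite /fps_dilate /fps_mul big_distrr /=.
apply: eq_bigr => i _; rewrite mulrACA -exprD subnKC // -ltnS.
exact: ltn_ord.
Qed.

Lemma fps_dilate1 c : fps_dilate c (fps_one F) = fps_one F.
Proof.
by apply/funext => -[|n]; rewrite /fps_dilate /fps_one ?mulr0 // expr0 mul1r.
Qed.

Lemma fps_dilate_pow c g j :
  fps_dilate c (fps_pow g j) = fps_pow (fps_dilate c g) j.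
Proof.
elim: j => [|j IHj]; first exact: fps_dilate1.
by rewrite !fps_powS fps_dilateM IHj.
Qed.

Lemma fps_dilate_exp c x : fps_dilate c (fps_exp x) = fps_exp (c * x).
Proof. by apply/funext => n; rewrite /fps_dilate /fps_exp mulrA exprMn. Qed.

(** Substituting $cz$ for $z$ sends $e^z - 1$ to $e^{cz} - 1$; the remaining factor $-1$ is the
    source of the signs [(- 1) ^+ i] below. *)
Lemma fps_one_sub_expE c :
  fps_sub (fps_one F) (fps_exp c) =
  fps_scale (- 1) (fps_dilate c (fps_sub (fps_exp 1) (fps_one F))).
Proof.
apply/funext => n; rewrite /fps_scale mulN1r.
have -> : fps_dilate c (fps_sub (fps_exp 1) (fps_one F)) =
          fps_sub (fps_exp c) (fps_one F).
  rewrite -{2}[c]mulr1 -fps_dilate_exp -[fps_one F in RHS](fps_dilate1 c).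
  by apply/funext => i; rewrite /fps_dilate /fps_sub mulrBr.
by rewrite /fps_sub opprB.
Qed.

End FormalPowerSeriesTheory.

Section Exponential.
Variable F : numFieldType.

Lemma fps_expD (x y : F) : fps_mul (fps_exp x) (fps_exp y) = fps_exp (x + y).
Proof.
have fact_neq0 i : i`!%:R != 0 :> F by rewrite pnatr_eq0 -lt0n fact_gt0.
apply/funext => n; rewrite /fps_mul /fps_exp addrC exprDn mulr_suml.
apply: eq_bigr => i _.
(* Writing $n!$ as $\binom{n}{i}\,i!\,(n-i)!$ reduces the claim to the binomial theorem term by
   term. *)
have /(congr1 (fun j => j%:R : F)) := bin_fact (leq_ord i).
rewrite -mulr_natr !natrM => <-.
have := fact_neq0 i; have := fact_neq0 (n - i)%N.
have : 'C(n, i)%:R != 0 :> F by rewrite pnatr_eq0 -lt0n bin_gt0 leq_ord.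
move=> C0 ni0 i0; field.
by rewrite C0 ni0 i0.
Qed.

Lemma fps_exp0 : fps_exp (0 : F) = fps_one F.
Proof.
by apply/funext => -[|n]; rewrite /fps_exp /fps_one ?expr0 ?divr1 // expr0n mul0r.
Qed.

Lemma polylog_quotient_coef (k n : nat) (b c q x : F) : q != 0 ->
  let u := fps_sub (fps_one F) (fps_exp (- q)) in
  fps_div (fps_comp (polylog k b) (fps_scale c u))
          (fps_mul (fps_exp (q * x)) u) n =
  \sum_(i < n.+1) c ^+ i.+1 / (i.+1%:R + b) ^+ k * (- 1) ^+ i * (- q) ^+ n *
    fps_mul (fps_exp x) (fps_pow (fps_sub (fps_exp 1) (fps_one F)) i) n.
Proof.
move=> q0 u; set v := fps_scale c u.
have u0 : u 0%N = 0 by rewrite /u /fps_sub /fps_one /fps_exp expr0 divr1 subrr.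
have v0 : v 0%N = 0 by rewrite /v /fps_scale u0 mulr0.
pose G := fps_comp (fun n => polylog k b n.+1) v.
(* The polylogarithm at $v = cu$ equals $v\,G$, so dividing by $e^{qxz}u$ leaves $c\,e^{-qxz}G$. *)
rewrite (@fps_divE _ _ _ (fps_scale c (fps_mul (fps_exp (- q * x)) G))).
- rewrite /fps_scale fps_mul_comp // mulr_sumr; apply: eq_bigr => i _.
  rewrite /v /u fps_one_sub_expE fps_scale_scale fps_pow_scale fps_mul_scaler.
  rewrite -fps_dilate_pow -fps_dilate_exp -fps_dilateM.
  rewrite /fps_scale /fps_dilate /polylog /= exprMn exprS.
  ring.
(* The divisor has no constant term, but its coefficient of $z$ is [q]. *)
- exists 1%N; rewrite /fps_mul !big_ord_recl big_ord0 /= u0 mulr0 !addr0.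
  rewrite /u /fps_sub /fps_one /fps_exp /= !expr0 !divr1 mul1r sub0r opprK.
  exact: q0.
- rewrite fps_comp_mulX // fps_mul_scalel fps_mul_scalel; congr fps_scale.
  rewrite -/G [fps_mul _ G]fps_mulC -fps_mulA [fps_mul _ (fps_mul _ u)]fps_mulA.
  by rewrite fps_expD mulNr addNr fps_exp0 fps_mul1l fps_mulC.
Qed.

End Exponential.

Theorem theorem17 (R : realType) (k : nat) (a q : R) (L : 'I_k -> R) (t : R)
    (hk : (1 <= k)%N) (ha0 : a != 0) (hq : q != 0) (hL : forall i, L i != 0)
    (ha : forall j : nat, a + j%:R != 0)
    (ht : is_arg (\prod_(i < k) L i) t)
    (n m : nat) (x : R[i]) :
  polyBernoulli a q L t n m x =
  ((a + m%:R) ^+ k / a ^+ k)%:C *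
  \sum_(i < n.+1)
    i`!%:R * (- q%:C) ^+ (n - i) * lpow (\prod_(j < k) L j) t a i
    / ((a + m%:R + i%:R) ^+ k)%:C * wstirling2 n i x.
Proof.
have qC0 : q%:C != 0 by rewrite fmorph_eq0.
have l0 : (\prod_(j < k) L j)%:C != 0.
  by rewrite fmorph_eq0; apply/prodf_neq0 => i _; exact: hL.
rewrite /polyBernoulli {1}/fps_scale polylog_quotient_coef //.
rewrite !mulr_sumr; apply: eq_bigr => i _.
have i0 : i`!%:R != 0 :> R[i] by rewrite pnatr_eq0 -lt0n fact_gt0.
(* Here $q^i$ will cancel against the denominator of $(l/q)^{i+1}$, and the sign against the one
   from the power of $1 - e^{-qz}$. *)
have qni : (- q%:C) ^+ n = (- q%:C) ^+ (n - i) * ((- 1) ^+ i * q%:C ^+ i).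
  by rewrite -exprMn mulN1r -exprD subnK // leq_ord.
have sgn : (- 1) ^+ i * (- 1) ^+ i = 1 :> R[i] by rewrite -expr2 sqrr_sign.
have -> : (i.+1%:R + (a + m%:R - 1)%:C) ^+ k = ((a + m%:R + i%:R) ^+ k)%:C.
  rewrite rmorphXn /=; congr (_ ^+ k).
  by rewrite -natr1 !rmorphD rmorphN rmorph1 !rmorph_nat; ring.
rewrite /wstirling2 /fps_scale /lpow qni -exprnP exprN1 /=.
(* The separated factors $l$ and $1/q$ absorb the $l^{-1}$ and the $q$ of the prefactor
   $q\,l^{a-1}$. *)
have -> : (\prod_(j < k) L j / q)%:C ^+ i.+1 =
    (\prod_(j < k) L j)%:C * (\prod_(j < k) L j)%:C ^+ i / (q%:C * q%:C ^+ i).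
  by rewrite rmorphM /= fmorphV exprMn exprVn !exprS.
have qi0 : q%:C ^+ i != 0 by rewrite expf_neq0.
(* Abstracting the subterms leaves an identity of rational expressions for [field], up to the
   relation [s * s = 1]. *)
move: (fps_mul _ _ n : R[i]) ((_ / _)%:C : R[i]) ((_ ^+ k)%:C^-1 : R[i]) => S K D.
move: ((- q%:C) ^+ (n - i)) (q%:C ^+ i) qi0 ((- 1) ^+ i) sgn {qni} => qni qi qi0 s.
move: (_ * cis _) ((\prod_(j < k) L j)%:C ^+ i) => la li.
move: (q%:C) qC0 ((\prod_(j < k) L j)%:C) l0 (n`!%:R) (i`!%:R) i0.
move=> q' q'0 l l0 nf f f0 ss.
transitivity (s * s * (nf * la * li * K * D * qni * S)).
  by field; rewrite qi0 q'0 l0.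
by rewrite ss; field.
Qed.
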